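(* Let $\mathsf{K}$ be any variety of Sugihara monoids. Then every $\mathsf{K}$-epimorphism is surjective; i.e., every axiomatic extension of the relevance logic $\mathbf{RM}^{\mathbf{t}}$ has the infinite Beth property.
   Context: A commutative residuated lattice (CRL) is an algebra $\langle A;\cdot,\to,\wedge,\vee,e\rangle$ such that $\langle A;\wedge,\vee\rangle$ is a lattice, $\langle A;\cdot,e\rangle$ is a commutative monoid, and $x\cdot y\leqslant z\iff x\leqslant y\to z$, where $\leqslant$ is the lattice order. It is idempotent if $a\cdot a=a$ for all $a$, and distributive if its lattice reduct is distributive. An involution on a CRL is a unary operation $\sim$ with $\sim\sim a=a$ and $a\to\sim b=b\to\sim a$ for all $a,b$; an involutive CRL is the expansion of a CRL by an involution. A Sugihara monoid is an idempotent distributive involutive CRL; these form a variety $\mathsf{SM}$. A class $\mathsf{K}$ of similar algebras is regarded as a category whose morphisms are all algebraic homomorphisms between members of $\mathsf{K}$. A $\mathsf{K}$-morphism $h\colon A\to B$ is a $\mathsf{K}$-epimorphism if, for all $\mathsf{K}$-morphisms $f,g$ from $B$ to a single member of $\mathsf{K}$, $f\circ h=g\circ h$ implies $f=g$. $\mathbf{RM}^{\mathbf{t}}$ (R-mingle with the Ackermann constant, of Anderson and Belnap) is the logic algebraized by $\mathsf{SM}$: $\Gamma\vdash\alpha$ iff there is a finite $\Gamma'\subseteq\Gamma$ such that, in every Sugihara monoid, every valuation giving each member of $\Gamma'$ a value $\geqslant e$ gives $\alpha$ a value $\geqslant e$. Its axiomatic extensions are the logics similarly determined by the subvarieties of $\mathsf{SM}$.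 Write $\alpha\leftrightarrow\beta$ for $(\alpha\to\beta)\wedge(\beta\to\alpha)$. The infinite Beth property for a logic $\vdash$ says the following. Let $X$ and $Z$ be disjoint sets of variables (of arbitrary, possibly infinite cardinality, arbitrarily many variables being available) and $\Gamma$ a (possibly infinite) set of formulas over $X\cup Z$. Suppose that $\Gamma\cup\sigma[\Gamma]\vdash z\leftrightarrow\sigma(z)$ for all $z\in Z$ and all uniform substitutions $\sigma$ (of formulas for variables) such that $\sigma(x)=x$ for all $x\in X$, where the formulas in the range of $\sigma|_{X\cup Z}$ may involve arbitrarily many variables beyond $X\cup Z$. Then for each $z\in Z$ there is a formula $\varphi_z$ over $X$ only such that $\Gamma\vdash z\leftrightarrow\varphi_z$. (It is assumed that $X\neq\emptyset$ unless the signature has constant symbols.) For an algebraizable logic, the infinite Beth property is known to be equivalent to surjectivity of all epimorphisms in the algebraic counterpart. *)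

(* Defs.v *)
From HB Require Import structures.
From mathcomp Require Import all_boot all_order.
From mathcomp Require Import boolp classical_sets functions cardinality.

Set Implicit Arguments.
Unset Strict Implicit.
Unset Printing Implicit Defensive.

Local Open Scope classical_set_scope.

(* In these structures the order of the lattice is boolean and the carrier is a
   choiceType; in the presence of the axioms of boolp, every type carries a
   choiceType structure and every lattice a boolean order, so this does not
   restrict the class of algebras.  Homomorphisms ignore the choice operator. *)

HB.mixin Record isResiduated (d : Order.disp_t) A
    of Order.Lattice d A & Monoid A := {
  imp : A -> A -> A;
  mul_commutative : commutative (@mul A);
  residuation : forall x y z : A, (x * y <= z)%g%O = (x <= imp y z)%O
}.

#[short(type="crlType")]
HB.structure Definition CRL d :=
  {A of isResiduated d A & Order.Lattice d A & Monoid A}.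

HB.mixin Record hasInvolution (d : Order.disp_t) A of CRL d A := {
  neg : A -> A;
  neg_involutive : involutive neg;
  imp_neg : forall x y : A, imp x (neg y) = imp y (neg x)
}.

#[short(type="involutiveCRLType")]
HB.structure Definition InvolutiveCRL d := {A of hasInvolution d A & CRL d A}.

HB.mixin Record isIdempotentCRL (d : Order.disp_t) A of CRL d A := {
  mul_idempotent : idempotent_op (@mul A)
}.

#[short(type="sugiharaType")]
HB.structure Definition SugiharaMonoid d :=
  {A of InvolutiveCRL d A & isIdempotentCRL d A & Order.DistrLattice d A}.

Record homomorphism d (A B : sugiharaType d) (f : A -> B) : Prop := {
  hom_monoid : monoid_morphism f;
  hom_imp : {morph f : x y / imp x y};
  hom_meet : {morph f : x y / Order.meet x y};
  hom_join : {morph f : x y / Order.join x y};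
  hom_neg : {morph f : x / neg x}
}.

Definition epimorphism d (K : set (sugiharaType d)) (A B : sugiharaType d)
    (h : A -> B) : Prop :=
  homomorphism h /\
  forall (C : sugiharaType d) (f g : B -> C), K C ->
    homomorphism f -> homomorphism g -> f \o h =1 g \o h -> f =1 g.

(* Terms in the signature of Sugihara monoids, which are also the formulas of
   the logic, over an arbitrary type V of variables. *)
Inductive formula (V : Type) : Type :=
| Var of V
| Unit
| Mul of formula V & formula V
| Imp of formula V & formula V
| Meet of formula V & formula V
| Join of formula V & formula V
| Neg of formula V.

Arguments Unit {V}.

Definition Iff V (a b : formula V) : formula V := Meet (Imp a b) (Imp b a).

Fixpoint eval d (A : sugiharaType d) V (v : V -> A) (a : formula V) : A :=
  match a with
  | Var x => v x
  | Unit => 1%g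
  | Mul a b => (eval v a * eval v b)%g
  | Imp a b => imp (eval v a) (eval v b)
  | Meet a b => Order.meet (eval v a) (eval v b)
  | Join a b => Order.join (eval v a) (eval v b)
  | Neg a => neg (eval v a)
  end.

Fixpoint subst V W (s : V -> formula W) (a : formula V) : formula W :=
  match a with
  | Var x => s x
  | Unit => Unit
  | Mul a b => Mul (subst s a) (subst s b)
  | Imp a b => Imp (subst s a) (subst s b)
  | Meet a b => Meet (subst s a) (subst s b)
  | Join a b => Join (subst s a) (subst s b)
  | Neg a => Neg (subst s a)
  end.

Definition rename V W (r : V -> W) : formula V -> formula W :=
  subst (fun x => Var (r x)).

Definition satisfies d (A : sugiharaType d) (e : formula nat * formula nat) :=
  forall v : nat -> A, eval v e.1 = eval v e.2.

Definition variety d (K : set (sugiharaType d)) : Prop :=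
  exists E : set (formula nat * formula nat),
    K = [set A | forall e, E e -> satisfies A e].

Definition logic := forall V : Type, set (formula V) -> formula V -> Prop.

Definition logic_of d (K : set (sugiharaType d)) : logic :=
  fun V G a =>
    exists G' : set (formula V),
      [/\ finite_set G', G' `<=` G &
        forall (A : sugiharaType d) (v : V -> A), K A ->
          (forall b, G' b -> (1%g <= eval v b)%O) -> (1%g <= eval v a)%O].

(* The axiomatic extensions of RM^t are the logics determined by the varieties
   of Sugihara monoids; RM^t itself is logic_of setT. *)
Definition RMt_axiomatic_extension d (L : logic) : Prop :=
  exists2 K : set (sugiharaType d), variety K &
    forall V (G : set (formula V)) (a : formula V),
      L V G a <-> logic_of K G a.

(* X + Z is the disjoint union of the two sets of variables, and W supplies the
   further variables that the substitution s may introduce. *)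
Definition infinite_Beth (L : logic) : Prop :=
  forall (X Z : Type) (G : set (formula (X + Z))),
    (forall (W : Type) (s : X + Z + W -> formula (X + Z + W)),
       (forall x : X, s (inl (inl x)) = Var (inl (inl x))) ->
       let G1 := rename inl @` G in
       forall z : Z,
         L _ (G1 `|` subst s @` G1)
           (Iff (Var (inl (inr z))) (s (inl (inr z))))) ->
    forall z : Z, exists p : formula X,
      L _ G (Iff (Var (inr z)) (rename inl p)).

(* Main.v *)
Require Import Defs.
From HB Require Import structures.
From mathcomp Require Import all_boot all_order.
From mathcomp Require Import boolp classical_sets cardinality.

Set Implicit Arguments.
Unset Strict Implicit.
Unset Printing Implicit Defensive.

Import Order.Theory.
Local Open Scope order_scope.
Local Open Scope group_scope.
Local Open Scope classical_set_scope.

(** Let [K] be a variety of Sugihara monoids, [A] a member of [K] and [S] a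
    subalgebra of [A] that omits an element [b].  Both parts of the theorem
    follow from [proper_subalgebra_separated]: some two homomorphisms from [A]
    into a member of [K] agree on [S] but are not equal.

    As every [x] is determined by [x /\ 1] and [~x /\ 1]
    ([negative_cone_decomposition]), we may suppose that [b <= 1].  Quotients
    are governed by deductive filters, and modulo a prime filter the order
    becomes total, by [prelinearity].  Zorn's lemma supplies a prime filter [U]
    that contains [b] but no element of [S] below [b].  Let [p] be the canonical
    map from [A] onto the chain [A/U].

    - Suppose that [p] maps [S] onto [A/U].  Let [V] be the filter generated by
      the intersection of [S] and [U], and [q] the canonical map onto [A/V].
      Elements of [S] that are congruent modulo [U] are congruent modulo [V],
      so a second homomorphism into [A/V] sends [x] to [q a] for any [a] in [S]
      that is congruent to [x] modulo [U].  It agrees with [q] on [S].  But [b]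
      is in [U] and not in [V], so [q b] is not above [1], while its image under
      the second homomorphism is.

    - Otherwise [p] maps [S] into a proper subalgebra of a chain, and we may
      replace [A] by that chain ([separated_chain]).  As [S] is closed under
      negation, it omits some [c <= ~c].  Factor out the filter generated by the
      elements of [S] above [c].  Let [r] be the canonical map.  Of the interval
      from [r c] to [~(r c)] only [1] is in the image of [S], and the new chain
      is odd, that is, [~1 = 1].  In an odd chain the map that collapses such
      an interval to [1] is an endomorphism ([collapse_homomorphism]).  Its
      composite with [r] agrees with [r] on [S] and differs from it at [c].

    All the algebras so built are quotients of [A], hence members of [K].

    For an epimorphism, take [S] to be its range.  For the infinite Beth
    property, let [B] be the Lindenbaum algebra of the set [G] of formulas over
    the disjoint union of [X] and [Z], which belongs to [K], and let [S] be the
    subalgebra of the classes of formulas over [X].  If the class of some [z]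
    were not in [S], there would be homomorphisms [f] and [g] from [B] into a
    member [C] of [K] that agree on [S] and are not equal.  Let the elements of
    [C] serve as the additional variables, and let the substitution send each
    [z] to the variable [g z].  The valuation that is [f] on the old variables
    and the identity on [C] then validates [G] and its substitution instance,
    so implicit definability yields [f z = g z] for all [z], and [f = g]. *)

(** * Quotients of preordered algebras *)

(** A preordered algebra that satisfies the laws of Sugihara monoids up to the
    equivalence induced by its preorder.  Two quotients have this form: that of
    a Sugihara monoid by a filter, and that of the formulas by a theory, where
    the equational laws fail before passing to classes. *)
Record presugihara (T : Type) := Presugihara {
  pmul : T -> T -> T;
  pone : T;
  pimp : T -> T -> T;
  pmeet : T -> T -> T;
  pjoin : T -> T -> T;
  pneg : T -> T;
  ple : T -> T -> Prop;
  ple_refl : forall x, ple x x;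
  ple_trans : forall y x z, ple x y -> ple y z -> ple x z;
  ple_meetl : forall x y, ple (pmeet x y) x;
  ple_meetr : forall x y, ple (pmeet x y) y;
  ple_meet : forall x y z, ple z x -> ple z y -> ple z (pmeet x y);
  ple_joinl : forall x y, ple x (pjoin x y);
  ple_joinr : forall x y, ple y (pjoin x y);
  ple_join : forall x y z, ple x z -> ple y z -> ple (pjoin x y) z;
  ple_distr : forall x y z,
    ple (pmeet (pjoin x y) z) (pjoin (pmeet x z) (pmeet y z));
  ple_mulA : forall x y z, ple (pmul x (pmul y z)) (pmul (pmul x y) z);
  ple_mulC : forall x y, ple (pmul x y) (pmul y x);
  ple_mul1 : forall x, ple (pmul pone x) x;
  ple_1mul : forall x, ple x (pmul pone x);
  ple_mulI : forall x, ple (pmul x x) x;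
  ple_Imul : forall x, ple x (pmul x x);
  ple_res : forall x y z, ple (pmul x y) z <-> ple x (pimp y z);
  ple_negK : forall x, ple (pneg (pneg x)) x;
  ple_Kneg : forall x, ple x (pneg (pneg x));
  ple_imp_neg : forall x y, ple (pimp x (pneg y)) (pimp y (pneg x))
}.

Section Quotient.
Context (d : Order.disp_t) (T : Type) (P : presugihara T).

Notation mu := (pmul P).
Notation im := (pimp P).
Notation me := (pmeet P).
Notation jo := (pjoin P).
Notation ne := (pneg P).
Notation le := (ple P).

Local Hint Resolve ple_refl : core.

Lemma ple_mul x x' y y' : le x x' -> le y y' -> le (mu x y) (mu x' y').
Proof.
move=> xx' yy'; apply: (@ple_trans _ _ (mu x' y)).
  by apply/ple_res/(ple_trans xx')/ple_res.
apply: ple_trans (ple_mulC _ _ _) _; apply: ple_trans (ple_mulC _ _ _).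
by apply/ple_res/(ple_trans yy')/ple_res.
Qed.

Lemma ple_app x y : le (mu (im x y) x) y.
Proof. exact/ple_res. Qed.

Lemma ple_imp x x' y y' : le x' x -> le y y' -> le (im x y) (im x' y').
Proof.
move=> xx' yy'; apply/ple_res/(ple_trans _ yy').
by apply: ple_trans (ple_app x y); apply: ple_mul.
Qed.

Lemma ple_one x y : le (pone P) (im x y) <-> le x y.
Proof.
rewrite -ple_res; split=> h; [apply: ple_trans h|apply: ple_trans h].
  exact: ple_1mul.
exact: ple_mul1.
Qed.

Lemma ple_neg x y : le x y -> le (ne y) (ne x).
Proof.
move=> xy; apply/ple_one/(ple_trans _ (ple_imp_neg _ _ _))/ple_one.
exact/(ple_trans xy)/ple_Kneg.
Qed.

Definition equivalent x y := le x y /\ le y x.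

(** Classes are bare predicates and not members of [set T]: since varieties are
    sets of algebras, the universe of [set] is larger than that of carriers. *)
Definition class (x : T) : T -> Prop := equivalent x.

Definition quotient := {A : T -> Prop | exists x, A = class x}.

HB.instance Definition _ := gen_eqMixin quotient.
HB.instance Definition _ := gen_choiceMixin quotient.

Definition pi (x : T) : quotient := exist _ (class x) (ex_intro _ x erefl).
Definition lift (u : quotient) : T := projT1 (cid (projT2 u)).

Lemma pi_eq x y : equivalent x y -> pi x = pi y.
Proof.
move=> [xy yx]; apply: eq_exist; apply/funext=> z; apply/propext.
split=> -[h h']; split;
  by [apply: (ple_trans yx)|apply: (ple_trans h')|
      apply: (ple_trans xy)|apply: (ple_trans h')].
Qed.

Lemma liftK u : pi (lift u) = u.
Proof.
by case: u => A e; apply: eq_exist; rewrite /lift; case: (cid _) => x /= ->.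
Qed.

Lemma lift_pi x : equivalent (lift (pi x)) x.
Proof.
have e : class (lift (pi x)) = class x :=
  congr1 (@proj1_sig _ _) (liftK (pi x)).
by rewrite -[equivalent _ x]/(class _ x) e.
Qed.

Definition qmul u v := pi (mu (lift u) (lift v)).
Definition qone := pi (pone P).
Definition qimp u v := pi (im (lift u) (lift v)).
Definition qmeet u v := pi (me (lift u) (lift v)).
Definition qjoin u v := pi (jo (lift u) (lift v)).
Definition qneg u := pi (ne (lift u)).
Definition qle u v := `[< le (lift u) (lift v) >].

Lemma qleP x y : qle (pi x) (pi y) <-> le x y.
Proof.
have [xl lx] := lift_pi x; have [yl ly] := lift_pi y.
rewrite /qle asboolE; split=> h.
  by apply: (ple_trans lx) (ple_trans h _).
by apply: (ple_trans xl) (ple_trans h _).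
Qed.

Lemma pi_mul x y : pi (mu x y) = qmul (pi x) (pi y).
Proof.
have [xl lx] := lift_pi x; have [yl ly] := lift_pi y.
by apply: pi_eq; split; apply: ple_mul.
Qed.

Lemma pi_imp x y : pi (im x y) = qimp (pi x) (pi y).
Proof.
have [xl lx] := lift_pi x; have [yl ly] := lift_pi y.
by apply: pi_eq; split; apply: ple_imp.
Qed.

Lemma pi_neg x : pi (ne x) = qneg (pi x).
Proof.
by have [xl lx] := lift_pi x; apply: pi_eq; split; apply: ple_neg.
Qed.

Lemma pi_meet x y : pi (me x y) = qmeet (pi x) (pi y).
Proof.
have [xl lx] := lift_pi x; have [yl ly] := lift_pi y.
apply: pi_eq; split; apply: ple_meet;
  (apply: ple_trans; [exact: ple_meetl|done]) ||
  (apply: ple_trans; [exact: ple_meetr|done]).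
Qed.

Lemma pi_join x y : pi (jo x y) = qjoin (pi x) (pi y).
Proof.
have [xl lx] := lift_pi x; have [yl ly] := lift_pi y.
apply: pi_eq; split; apply: ple_join;
  (apply: (ple_trans _ (ple_joinl _ _ _)); done) ||
  (apply: (ple_trans _ (ple_joinr _ _ _)); done).
Qed.

Lemma quotientP (A : quotient -> Prop) : (forall x, A (pi x)) -> forall u, A u.
Proof. by move=> h u; rewrite -(liftK u). Qed.

Lemma qle_refl : reflexive qle.
Proof. by elim/quotientP=> x; apply/qleP. Qed.

Lemma qle_anti : antisymmetric qle.
Proof.
elim/quotientP=> x; elim/quotientP=> y /andP[/qleP xy /qleP yx].
exact: pi_eq.
Qed.

Lemma qle_trans : transitive qle.
Proof.
elim/quotientP=> x; elim/quotientP=> y; elim/quotientP=> z /qleP a /qleP b.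
by apply/qleP/(ple_trans a b).
Qed.

HB.instance Definition _ :=
  Order.Le_isPOrder.Build d quotient qle_refl qle_anti qle_trans.

Lemma le_pi x y : pi x <= pi y <-> le x y.
Proof. exact: qleP. Qed.

Lemma qlexI u v w : (u <= qmeet v w) = (u <= v) && (u <= w).
Proof.
elim/quotientP: u => u; elim/quotientP: v => v; elim/quotientP: w => w.
rewrite -pi_meet; apply/idP/andP=> [/le_pi h|[/le_pi a /le_pi b]].
  split; apply/le_pi; apply: ple_trans h _; [exact: ple_meetl|exact: ple_meetr].
exact/le_pi/ple_meet.
Qed.

Lemma qleUx u v w : (qjoin u v <= w) = (u <= w) && (v <= w).
Proof.
elim/quotientP: u => u; elim/quotientP: v => v; elim/quotientP: w => w.
rewrite -pi_join; apply/idP/andP=> [/le_pi h|[/le_pi a /le_pi b]].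
  split; apply/le_pi; apply: ple_trans h.
    exact: ple_joinl.
  exact: ple_joinr.
exact/le_pi/ple_join.
Qed.

HB.instance Definition _ :=
  Order.POrder_isMeetSemilattice.Build d quotient qlexI.
HB.instance Definition _ :=
  Order.POrder_isJoinSemilattice.Build d quotient qleUx.

Lemma meet_pi x y : Order.meet (pi x) (pi y) = pi (me x y).
Proof. exact/esym/pi_meet. Qed.

Lemma join_pi x y : Order.join (pi x) (pi y) = pi (jo x y).
Proof. exact/esym/pi_join. Qed.

Lemma qmeetUl : @left_distributive quotient quotient Order.meet Order.join.
Proof.
move=> u v w; apply/eqP; rewrite eq_le leUx !leI2 ?leUl ?leUr // !andbT.
elim/quotientP: u => u; elim/quotientP: v => v; elim/quotientP: w => w.
rewrite !(meet_pi, join_pi).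
exact/le_pi/ple_distr.
Qed.

HB.instance Definition _ :=
  Order.Lattice_Meet_isDistrLattice.Build d quotient qmeetUl.

Lemma qmulA : associative qmul.
Proof.
elim/quotientP=> x; elim/quotientP=> y; elim/quotientP=> z.
rewrite -!pi_mul; apply: pi_eq; split; first exact: ple_mulA.
have C := @ple_mulC _ P.
apply: ple_trans (C _ _) _; apply: ple_trans (ple_mul (ple_refl _ _) (C _ _)) _.
apply: ple_trans (ple_mulA _ _ _ _) _; apply: ple_trans (C _ _) _.
exact: (ple_mul (ple_refl _ _) (C _ _)).
Qed.

Lemma qmulC : commutative qmul.
Proof.
elim/quotientP=> x; elim/quotientP=> y.
by rewrite -!pi_mul; apply: pi_eq; split; apply: ple_mulC.
Qed.

Lemma qmul1 : left_id qone qmul.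
Proof.
elim/quotientP=> x; rewrite -!pi_mul; apply: pi_eq.
by split; [apply: ple_mul1|apply: ple_1mul].
Qed.

Lemma q1mul : right_id qone qmul.
Proof. by move=> u; rewrite qmulC qmul1. Qed.

HB.instance Definition _ := isMonoid.Build quotient qmulA qmul1 q1mul.

Lemma mul_pi x y : pi x * pi y = pi (mu x y).
Proof. exact/esym/pi_mul. Qed.

Lemma qres (u v w : quotient) : (u * v <= w) = (u <= qimp v w).
Proof.
elim/quotientP: u => u; elim/quotientP: v => v; elim/quotientP: w => w.
rewrite mul_pi -pi_imp.
by apply/idP/idP => /le_pi/ple_res/le_pi.
Qed.

HB.instance Definition _ := isResiduated.Build d quotient qmulC qres.

Lemma qnegK : involutive qneg.
Proof.
elim/quotientP=> x; rewrite -!pi_neg; apply: pi_eq.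
by split; [apply: ple_negK|apply: ple_Kneg].
Qed.

Lemma imp_pi x y : imp (pi x) (pi y) = pi (im x y).
Proof. exact/esym/pi_imp. Qed.

Lemma qimp_neg (u v : quotient) : imp u (qneg v) = imp v (qneg u).
Proof.
elim/quotientP: u => u; elim/quotientP: v => v.
by rewrite -!pi_neg !imp_pi; apply: pi_eq; split; apply: ple_imp_neg.
Qed.

HB.instance Definition _ := hasInvolution.Build d quotient qnegK qimp_neg.

Lemma qmulI : idempotent_op qmul.
Proof.
elim/quotientP=> x; rewrite -!pi_mul; apply: pi_eq.
by split; [apply: ple_mulI|apply: ple_Imul].
Qed.

HB.instance Definition _ := isIdempotentCRL.Build d quotient qmulI.

Lemma presugihara_quotient : exists (C : sugiharaType d) (p : T -> C),
  [/\ forall c, exists x, p x = c, forall x y, p x <= p y <-> le x y,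
      p (pone P) = 1 &
      [/\ forall x y, p (mu x y) = p x * p y,
          forall x y, p (im x y) = imp (p x) (p y),
          forall x y, p (me x y) = Order.meet (p x) (p y),
          forall x y, p (jo x y) = Order.join (p x) (p y) &
          forall x, p (ne x) = neg (p x)]].
Proof.
exists (SugiharaMonoid.clone d quotient _), pi; split=> [c|||]; last 1 first.
- split; [exact: pi_mul|exact: pi_imp|exact: pi_meet|exact: pi_join|].
  exact: pi_neg.
- by exists (lift c); rewrite liftK.
- exact: le_pi.
- by [].
Qed.

End Quotient.

(** * Arithmetic of Sugihara monoids *)

Section Arithmetic.
Context (d : Order.disp_t) (A : sugiharaType d).
Implicit Types x y z : A.

Lemma mulgC x y : x * y = y * x.
Proof. exact: mul_commutative. Qed.

Lemma mulgg x : x * x = x.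
Proof. exact: mul_idempotent. Qed.

Lemma mulgACA x y z t : (x * y) * (z * t) = (x * z) * (y * t).
Proof. by rewrite -!mulgA; congr mul; rewrite !mulgA (mulgC y z). Qed.

Lemma negK : involutive (@neg d A).
Proof. exact: neg_involutive. Qed.

Lemma one_le_imp x y : (1 <= imp x y) = (x <= y).
Proof. by rewrite -residuation mul1g. Qed.

Lemma le_mul x x' y y' : x <= x' -> y <= y' -> x * y <= x' * y'.
Proof.
move=> xx' yy'; apply: (@le_trans _ _ (x' * y)).
  by rewrite residuation (le_trans xx') // -residuation.
by rewrite mulgC [leRHS]mulgC residuation (le_trans yy') // -residuation.
Qed.

Lemma imp_mul_le x y : imp x y * x <= y.
Proof. by rewrite residuation. Qed.

Lemma imp1 y : imp 1 y = y.
Proof.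
apply/eqP; rewrite eq_le -residuation mulg1 lexx andbT.
by have := imp_mul_le 1 y; rewrite mulg1.
Qed.

Lemma imp_mulE x y z : imp (x * y) z = imp x (imp y z).
Proof.
apply/eqP; rewrite eq_le -!residuation -mulgA imp_mul_le /=.
rewrite mulgA (le_trans _ (imp_mul_le y z)) // le_mul //.
exact: imp_mul_le.
Qed.

Lemma imp_negE x y : imp x (neg y) = neg (x * y).
Proof. by rewrite -[RHS]imp1 [RHS]imp_neg imp_mulE (imp_neg y) imp1. Qed.

Lemma impE x y : imp x y = neg (x * neg y).
Proof. by rewrite -imp_negE negK. Qed.

Lemma mul_le_neg1 x y : (x * y <= neg 1) = (x <= neg y).
Proof. by rewrite residuation imp_negE mulg1. Qed.

Lemma mul_neg_le x : x * neg x <= neg 1.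
Proof. by rewrite mul_le_neg1 negK. Qed.

Lemma le_neg x y : (neg x <= neg y) = (y <= x).
Proof. by rewrite -mul_le_neg1 mulgC mul_le_neg1 negK. Qed.

Lemma le_negl x y : (neg x <= y) = (neg y <= x).
Proof. by rewrite -{1}[y]negK le_neg. Qed.

Lemma neg1_le1 : neg 1 <= 1 :> A.
Proof. by rewrite -[leRHS]negK -mul_le_neg1 mulgg. Qed.

Lemma neg_meet x y : neg (Order.meet x y) = Order.join (neg x) (neg y).
Proof.
apply/eqP; rewrite eq_le leUx !le_neg leIl leIr andbT.
by rewrite le_negl lexI (le_negl _ x) (le_negl _ y) leUl leUr.
Qed.

Lemma neg_join x y : neg (Order.join x y) = Order.meet (neg x) (neg y).
Proof. by apply: (can_inj negK); rewrite neg_meet !negK. Qed.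

Lemma meet_le_mul x y : Order.meet x y <= x * y.
Proof. by rewrite -[leLHS]mulgg le_mul ?leIl ?leIr. Qed.

Lemma mul_le_join x y : x * y <= Order.join x y.
Proof. by rewrite -[leRHS]mulgg le_mul ?leUl ?leUr. Qed.

Lemma imp_trans x y z : Order.meet (imp x y) (imp y z) <= imp x z.
Proof.
apply: le_trans (meet_le_mul _ _) _.
rewrite -residuation (mulgC (imp x y)) -mulgA.
by rewrite (le_trans _ (imp_mul_le y z)) // le_mul ?imp_mul_le.
Qed.

(** The negation of the right-hand side is at most
    [(x * ~y) * (y * ~x) = (x * ~x) * (y * ~y)], hence at most
    [~1 * ~1 = ~1]. *)
Lemma prelinearity x y : 1 <= Order.join (imp x y) (imp y x).
Proof.
rewrite -le_neg neg_join !impE !negK.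
apply: le_trans (meet_le_mul _ _) _.
rewrite (mulgC y) mulgACA (mulgC (neg y)).
by rewrite -[leRHS]mulgg le_mul ?mul_neg_le.
Qed.

Lemma excluded_middle x : 1 <= Order.join x (neg x).
Proof.
rewrite -le_neg neg_join negK meetC.
exact: le_trans (meet_le_mul _ _) (mul_neg_le _).
Qed.

(** Because of this identity, a subalgebra with the same negative cone as the
    whole algebra is the whole algebra.  In a chain, one of the two factors is
    [x] and the other acts on it as a unit; the proof below replaces the case
    distinction by distributivity and [excluded_middle]. *)
Lemma negative_cone_decomposition x :
  x = Order.meet x 1 * neg (Order.meet (neg x) 1).
Proof.
rewrite neg_meet negK; set c := Order.meet x 1.
apply/eqP; rewrite eq_le; apply/andP; split.
  apply: (@le_trans _ _ (c * x)); last by rewrite le_mul ?leUl.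
  set w := Order.meet (neg x) 1.
  have w1 : 1 <= Order.join c w.
    by rewrite -meetUl lexI excluded_middle lexx.
  have xw : x * w <= c.
    rewrite lexI; apply/andP; split.
      by rewrite -[leRHS]mulg1 le_mul ?leIr.
    apply: le_trans neg1_le1; apply: le_trans (mul_neg_le x).
    by rewrite le_mul ?leIl.
  rewrite -[leLHS]mul1g residuation (le_trans w1) // leUx.
  rewrite -!residuation lexx /=.
  have -> : w * x = x * (x * w) by rewrite mulgA mulgg mulgC.
  by rewrite (mulgC c) le_mul.
rewrite mulgC residuation leUx -!residuation; apply/andP; split.
  by rewrite -{2}[x]mulgg le_mul ?leIl.
apply: (@le_trans _ _ (1 * c)); first by rewrite le_mul ?neg1_le1.
by rewrite mul1g leIl.
Qed.

End Arithmetic.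

(** * Homomorphisms, subalgebras and filters *)

Section Homomorphisms.
Context (d : Order.disp_t).
Implicit Types A B C : sugiharaType d.

Lemma homomorphism_of_mul_meet_neg A B (f : A -> B) :
    f 1 = 1 -> {morph f : x y / x * y} ->
    {morph f : x y / Order.meet x y} -> {morph f : x / neg x} ->
  homomorphism f.
Proof.
move=> f1 fM fI fN; split=> // x y; first by rewrite !impE fN fM fN.
by rewrite -[Order.join x y]negK -[RHS]negK !neg_join fN fI !fN.
Qed.

Lemma homomorphism_comp A B C (f : A -> B) (g : B -> C) :
  homomorphism f -> homomorphism g -> homomorphism (g \o f).
Proof.
move=> [[f1 fM] _ fI _ fN] [[g1 gM] _ gI _ gN].
by apply: homomorphism_of_mul_meet_neg => [|x y|x y|x] /=;
  rewrite ?f1 ?g1 ?fM ?gM ?fI ?gI ?fN ?gN.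
Qed.

Lemma homomorphism_le A B (f : A -> B) :
  homomorphism f -> {homo f : x y / x <= y}.
Proof. by move=> [_ _ fI _ _] x y /meet_idPl xy; rewrite -xy fI leIr. Qed.

Lemma eval_homomorphism A B (f : A -> B) V (v : V -> A) a :
  homomorphism f -> f (eval v a) = eval (f \o v) a.
Proof.
move=> [[f1 fM] fi fI fJ fN].
by elim: a => //= [a <- b <-|a <- b <-|a <- b <-|a <- b <-|a <-].
Qed.

Lemma eval_eq A V (v w : V -> A) : v =1 w -> eval v =1 eval w.
Proof.
by move=> vw; elim=> //= [a -> b ->|a -> b ->|a -> b ->|a -> b ->|a ->].
Qed.

Lemma variety_image (K : set (sugiharaType d)) A C (p : A -> C) :
  variety K -> K A -> homomorphism p -> (forall c, exists x, p x = c) -> K C.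
Proof.
move=> [E ->] /= KA hp sp e Ee v; pose w n := projT1 (cid (sp (v n))).
have wv : p \o w =1 v by move=> n; rewrite /= /w; case: (cid _).
by rewrite -!(eval_eq wv) -!eval_homomorphism // KA.
Qed.

Record subalgebra A (S : A -> Prop) : Prop := {
  sub1 : S 1;
  sub_mul : forall x y, S x -> S y -> S (x * y);
  sub_meet : forall x y, S x -> S y -> S (Order.meet x y);
  sub_neg : forall x, S x -> S (neg x)
}.

Lemma sub_join A (S : A -> Prop) x y :
  subalgebra S -> S x -> S y -> S (Order.join x y).
Proof.
by move=> [_ _ SI SN] Sx Sy; rewrite -[Order.join x y]negK neg_join; auto.
Qed.

Lemma sub_imp A (S : A -> Prop) x y :
  subalgebra S -> S x -> S y -> S (imp x y).
Proof. by move=> [_ SM _ SN] Sx Sy; rewrite impE; auto. Qed.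

Lemma subalgebra_image A B (S : A -> Prop) (f : A -> B) :
  subalgebra S -> homomorphism f ->
  subalgebra (fun y => exists2 x, S x & f x = y).
Proof.
move=> [S1 SM SI SN] [[f1 fM] _ fI _ fN]; split.
- by exists 1.
- by move=> _ _ [x Sx <-] [y Sy <-]; exists (x * y); auto.
- by move=> _ _ [x Sx <-] [y Sy <-]; exists (Order.meet x y); auto.
- by move=> _ [x Sx <-]; exists (neg x); auto.
Qed.

(** Closure under multiplication is automatic, since
    [Order.meet x y <= x * y] in the presence of idempotence. *)
Record deductive_filter A (F : A -> Prop) : Prop := {
  filter1 : F 1;
  filter_le : forall x y, x <= y -> F x -> F y;
  filter_meet : forall x y, F x -> F y -> F (Order.meet x y)
}.

Section FilterQuotient.
Context (A : sugiharaType d) (F : A -> Prop) (fF : deductive_filter F).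

Let leF (x y : A) := F (imp x y).

Lemma filter_of_le x y : x <= y -> leF x y.
Proof. by rewrite -one_le_imp => /(filter_le fF); apply; apply: filter1. Qed.

Lemma filter_preorder_trans y x z : leF x y -> leF y z -> leF x z.
Proof.
by move=> xy yz; apply: (filter_le fF (imp_trans x y z)); apply: filter_meet.
Qed.

Lemma filter_preorder_meet x y z : leF z x -> leF z y -> leF z (Order.meet x y).
Proof.
move=> zx zy; apply: (filter_le fF _ (filter_meet fF zx zy)).
by rewrite -residuation lexI !residuation leIl leIr.
Qed.

Lemma filter_preorder_join x y z : leF x z -> leF y z -> leF (Order.join x y) z.
Proof.
move=> xz yz; apply: (filter_le fF _ (filter_meet fF xz yz)).
rewrite -residuation mulgC residuation leUx -!residuation.
by rewrite !(mulgC _ (Order.meet _ _)) !residuation leIl leIr.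
Qed.

Lemma filter_preorder_residuation x y z : leF (x * y) z <-> leF x (imp y z).
Proof. by rewrite /leF imp_mulE. Qed.

Definition filter_presugihara : presugihara A.
Proof.
refine (@Presugihara A mul 1 (@imp d A) Order.meet Order.join (@neg d A) leF
  _ filter_preorder_trans _ _ filter_preorder_meet _ _ filter_preorder_join
  _ _ _ _ _ _ _ filter_preorder_residuation _ _ _) => *;
  apply: filter_of_le; rewrite ?(meetUl, mulgA, mul1g, mulgg, negK) //.
- by rewrite leIl.
- by rewrite leIr.
- by rewrite leUl.
- by rewrite leUr.
- by rewrite mulgC.
- by rewrite imp_neg.
Defined.

Lemma filter_quotient : exists (C : sugiharaType d) (p : A -> C),
  [/\ homomorphism p, forall c, exists x, p x = c &
      forall x y, p x <= p y <-> F (imp x y)].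
Proof.
have [C [p [sp pF p1 [pM _ pI _ pN]]]] :=
  presugihara_quotient d filter_presugihara.
by exists C, p; split=> //; apply: homomorphism_of_mul_meet_neg.
Qed.

End FilterQuotient.

Lemma one_le_quotient A C (F : A -> Prop) (p : A -> C) :
    homomorphism p -> (forall x y, p x <= p y <-> F (imp x y)) ->
  forall x, 1 <= p x <-> F x.
Proof. by move=> [[p1 _] _ _ _ _] pF x; rewrite -p1 pF imp1. Qed.

(** * Chains *)

Definition chain A := forall x y : A, (x <= y) || (y <= x).

(** Multiplication on a chain selects one of its two arguments.  The product
    always lies between the meet and the join.  If [x <= ~y] then [x * y <= ~1],
    which forces the lower bound.  Otherwise totality gives [1 <= x * y], and
    idempotence forces the upper bound. *)
Lemma chain_mul A (x y : A) : chain A ->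
  x * y = if x <= neg y then Order.meet x y else Order.join x y.
Proof.
move=> tot; apply/eqP; rewrite eq_le.
have [xy|nxy] := boolP (x <= neg y).
  rewrite meet_le_mul andbT.
  wlog le_xy : x y xy / (x <= y) => [h|].
    have /orP[|yx] := tot x y; first exact: h.
    by rewrite mulgC meetC h // -[leLHS]negK le_neg.
  have -> : Order.meet x y = x by apply/meet_idPl.
  rewrite -[leRHS]negK -mul_le_neg1 -mulgA (le_trans _ (mul_neg_le x)) //.
  by rewrite le_mul // -[leRHS]mulgg le_mul // -[leLHS]negK le_neg.
rewrite mul_le_join /=.
have xy1 : 1 <= x * y.
  have := excluded_middle (x * y).
  have /orP[/join_idPr ->|/join_idPl ->//] := tot (x * y) (neg (x * y)).
  by rewrite -[leLHS]negK le_neg mul_le_neg1 (negPf nxy).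
rewrite leUx; apply/andP; split.
  by rewrite -[leLHS]mulg1 -{2}[x]mulgg -mulgA le_mul.
by rewrite -[leLHS]mul1g -{2}[y]mulgg mulgA le_mul.
Qed.

(** The map is the canonical projection onto the quotient by the filter
    generated by [u], followed by a section of it.  The section exists because
    the class of [1], which is closed under [neg], is represented by
    [1 = ~1]. *)
Lemma collapse_homomorphism C (u : C) :
    chain C -> neg 1 = 1 :> C -> u <= 1 ->
  homomorphism (fun x : C => if u <= x <= neg u then 1 else x).
Proof.
move=> tot odd u1; pose N x := u <= x <= neg u.
have N1 : N 1 by rewrite /N u1 -odd le_neg.
have NN x : N (neg x) = N x.
  by rewrite /N le_neg andbC -[in LHS](negK u) le_neg negK.
have conv x y z : N x -> N z -> x <= y -> y <= z -> N y.
  move=> /andP[ux _] /andP[_ zu] xy yz.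
  by rewrite /N (le_trans ux) // (le_trans yz).
pose g x : C := if N x then 1 else x; rewrite -/g.
have gN x : g (neg x) = neg (g x) by rewrite /g NN; case: ifP; rewrite ?odd.
have g_mono x y : x <= y -> g x <= g y.
  rewrite /g => xy; case: (boolP (N x)) => Nx; case: (boolP (N y)) => Ny //.
    have /orP[//|y1] := tot 1 y.
    by rewrite (conv x y 1) in Ny.
  have /orP[//|x1] := tot x 1.
  by rewrite (conv 1 x y) in Nx.
have gI x y : g (Order.meet x y) = Order.meet (g x) (g y).
  wlog xy : x y / (x <= y) => [h|].
    have /orP[|yx] := tot x y; first exact: h.
    by rewrite meetC h // meetC.
  by rewrite (meet_idPl xy) (meet_idPl (g_mono _ _ xy)).
have gJ x y : g (Order.join x y) = Order.join (g x) (g y).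
  by rewrite -[Order.join x y]negK gN neg_join gI !gN neg_meet !negK.
apply: homomorphism_of_mul_meet_neg => // [|x y]; first by rewrite /g N1.
rewrite !chain_mul //; case: ifP => [/g_mono|nxy]; first by rewrite gN => ->.
case: ifP => // gxy.
(* Here [~y < x] and [g x <= g (~y)], so that [g] collapses both. *)
have yx : neg y <= x by have := tot x (neg y); rewrite nxy.
have e : g x = g (neg y).
  by apply/eqP; rewrite eq_le [in X in X && _]gN gxy g_mono.
have [gx1 gy1] : g x = 1 /\ g y = 1.
  move: e nxy; rewrite gN /g; do 2!case: ifP => //; rewrite ?odd.
  - by move=> /negP Ny Nx e; case: Ny; rewrite -NN -e.
  - by move=> Ny /negP Nx e; case: Nx; rewrite e.
  - by move=> _ _ ->; rewrite lexx.
by rewrite gJ gx1 gy1 meetxx joinxx.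
Qed.

End Homomorphisms.

(** * Separation of elements from subalgebras *)

Section Separation.
Context (d : Order.disp_t) (K : set (sugiharaType d)) (vK : variety K).
Implicit Types A B C : sugiharaType d.

(** The prime ideal theorem for distributive lattices; [b <= 1] makes the filter
    deductive. *)
Lemma prime_filter_avoiding A (I : A -> Prop) (b : A) :
    (forall x y, x <= y -> I y -> I x) ->
    (forall x y, I x -> I y -> I (Order.join x y)) ->
    ~ I b -> b <= 1 ->
  exists F : A -> Prop, [/\ deductive_filter F, F b, forall x, F x -> ~ I x &
    forall x y, F (Order.join x y) -> F x \/ F y].
Proof.
move=> Ile IJ nIb b1.
(* Membership of [b] is required of nonempty [F] only, so that the union of the
   empty chain qualifies. *)
pose P (F : set A) := [/\ forall x y, x <= y -> F x -> F y,
  forall x y, F x -> F y -> F (Order.meet x y),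
  forall x, F x -> ~ I x & forall x, F x -> F b].
have [F [[Fle FI FnI Fb] Fmax]] : exists F, P F /\ forall G, F `<` G -> ~ P G.
  apply: Zorn_bigcup => H HP Htot; split.
  - move=> x y xy [G HG Gx]; exists G => //.
    by have [h _ _ _] := HP _ HG; apply: h Gx.
  - move=> x y [G HG Gx] [G' HG' Gy].
    have [GG'|G'G] := Htot _ _ HG HG'.
      exists G' => //; have [_ h _ _] := HP _ HG'.
      by apply: h => //; apply: GG'.
    exists G => //; have [_ h _ _] := HP _ HG.
    by apply: h => //; apply: G'G.
  - by move=> x [G HG Gx]; have [_ _ h _] := HP _ HG; apply: h.
  - move=> x [G HG Gx]; exists G => //.
    by have [_ _ _ h] := HP _ HG; apply: h Gx.
have {}Fb : F b.
  have Pb : P [set x | b <= x].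
    split=> /=.
    - by move=> x y xy bx; apply: le_trans bx xy.
    - by move=> x y bx bY; rewrite lexI bx.
    - by move=> x bx /(Ile _ _ bx).
    - by [].
  apply: contrapT => nFb; apply: (Fmax _ _ Pb).
  by split=> [x Fx|/(_ b (lexx b))//]; case: nFb; apply: Fb Fx.
(* By maximality, adjoining an element outside [F] produces a filter that meets
   the ideal. *)
have adjoin x : ~ F x -> exists2 w, F w & I (Order.meet w x).
  move=> nFx; apply: contrapT => nw.
  apply: (Fmax [set y | exists2 w, F w & Order.meet w x <= y]).
    split=> [y Fy|/(_ x)]; first by exists y; rewrite ?leIl.
    by move=> h; apply/nFx/h; exists b; rewrite ?leIr.
  split=> /=.
  - by move=> y z yz [w Fw wy]; exists w => //; apply: le_trans wy yz.
  - move=> y z [w Fw wy] [w' Fw' wz]; exists (Order.meet w w'); first exact: FI.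
    rewrite lexI (le_trans _ wy) ?(le_trans _ wz) // leI2 ?leIl ?leIr //.
  - by move=> y [w Fw wy] Iy; apply: nw; exists w => //; apply: Ile wy Iy.
  - by move=> y _; exists b; rewrite ?leIl.
exists F; split=> //.
  by split=> //; apply: Fle b1 Fb.
move=> x y Fxy; apply: contrapT.
move=> /not_orP[/adjoin[w Fw Iw] /adjoin[w' Fw' Iw']].
apply: FnI (FI _ _ (FI _ _ Fw Fw') Fxy) _.
apply: Ile (IJ _ _ Iw Iw').
by rewrite meetUr leU2 // leI2 ?leIl ?leIr.
Qed.

Definition separated A (S : A -> Prop) :=
  exists (C : sugiharaType d) (f g : A -> C),
  [/\ K C, homomorphism f, homomorphism g, forall x, S x -> f x = g x &
      exists x, f x <> g x].

(** Modulo the filter [F] generated by the elements of [S] above [c], no element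
    of [S] lies from [c] up to [~c] except those congruent to [1], while [c]
    itself is not congruent to [1].  Hence collapsing that interval moves [c]
    and fixes the image of [S]. *)
Lemma separated_chain A (S : A -> Prop) c :
  K A -> chain A -> subalgebra S -> ~ S c -> separated S.
Proof.
move=> KA tot sS.
wlog cn : c / (c <= neg c) => [h nSc|nSc].
  have /orP[cn|cn] := tot c (neg c); first exact: (h c).
  apply: (h (neg c)); first by rewrite negK.
  by move=> /(sub_neg sS); rewrite negK.
have c_neg1 : c <= neg 1 by rewrite -[leLHS]mulgg mul_le_neg1.
have [S1 _ SI SN] := sS.
pose F x := exists2 a, S a & c <= a <= x.
have fF : deductive_filter F.
  split.
  - by exists (neg 1); [apply: SN|rewrite c_neg1 neg1_le1].
  - move=> x y xy [a Sa /andP[ca ax]]; exists a => //.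
    by rewrite ca (le_trans ax).
  - move=> x y [a Sa /andP[ca ax]] [a' Sa' /andP[ca' ay]].
    by exists (Order.meet a a'); [apply: SI|rewrite lexI ca ca' leI2].
have [D [p [hp sp pF]]] := filter_quotient fF.
have p1F := one_le_quotient hp pF.
have [[p1 _] _ _ _ pN] := hp.
have totD : chain D.
  move=> x y; have [x' <-] := sp x; have [y' <-] := sp y.
  by have /orP[|] := tot x' y' => /(homomorphism_le hp) ->; rewrite ?orbT.
(* [~1] is in [S] and above [c], hence in [F]. *)
have odd : neg 1 = 1 :> D.
  apply/eqP; rewrite eq_le neg1_le1 -p1 -pN p1; apply/p1F.
  by exists (neg 1); [apply: SN|rewrite c_neg1 lexx].
have pc1 : p c <= 1 by rewrite -odd -p1 -pN homomorphism_le.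
(* If [a'] in [S] witnesses [p c <= p a], then [c = c * c <= a' * c <= a], so
   that [a] is itself a generator of [F]. *)
have pSc a : S a -> p c <= p a -> 1 <= p a.
  move=> Sa /pF[a' Sa' /andP[ca' aca]]; apply/p1F; exists a => //.
  rewrite lexx andbT -[leLHS]mulgg; apply: le_trans (_ : a' * c <= a).
    by rewrite le_mul.
  by rewrite residuation.
pose g (x : D) := if p c <= x <= neg (p c) then 1 else x.
have hg : homomorphism g by apply: collapse_homomorphism.
exists D, p, (g \o p); split=> //.
- exact: variety_image hp sp.
- exact: homomorphism_comp.
- move=> a Sa /=; rewrite /g; case: ifP => // /andP[ca ac].
  apply/eqP; rewrite eq_le pSc // andbT -odd -[leLHS]negK le_neg -pN.
  apply: pSc; first exact: SN.
  by rewrite pN -[leLHS]negK le_neg.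
- exists c; rewrite /= /g lexx (le_trans pc1) /=; last first.
    by rewrite -odd le_neg.
  move=> pc; have /p1F[a Sa ca] : 1 <= p c by rewrite pc.
  by apply: nSc; rewrite (le_anti ca).
Qed.

(** If [S] maps onto the chain [A/U], then [A/U] is a quotient of [S], and it
    maps to [A/V], because [S] meets [U] and [V] in the same elements.  So [A]
    maps to [A/V] in two ways, directly and through [A/U], and the second sends
    [b], a member of [U], above [1].  If [S] does not map onto the chain, the
    problem passes to the chain. *)
Lemma proper_subalgebra_separated A (S : A -> Prop) b :
  K A -> subalgebra S -> ~ S b -> separated S.
Proof.
move=> KA sS; have [S1 SM SI SN] := sS.
wlog b1 : b / (b <= 1) => [h nSb|nSb].
  have [Sm|] := pselect (S (Order.meet b 1)); last by apply: h; rewrite leIr.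
  have [Sn|] := pselect (S (Order.meet (neg b) 1)); last first.
    by apply: h; rewrite leIr.
  by case: nSb; rewrite (negative_cone_decomposition b); auto.
(* [U] is to avoid the ideal generated by the elements of [S] below [b]. *)
pose I x := exists2 a, S a & x <= a <= b.
have [U [fU Ub UI Uprime]] : exists U : A -> Prop,
    [/\ deductive_filter U, U b, forall x, U x -> ~ I x &
        forall x y, U (Order.join x y) -> U x \/ U y].
  apply: prime_filter_avoiding => //.
  - move=> x y xy [a Sa /andP[ya ab]]; exists a => //.
    by rewrite ab (le_trans xy).
  - move=> x y [a Sa /andP[xa ab]] [a' Sa' /andP[ya ab']].
    by exists (Order.join a a'); [apply: sub_join|rewrite leU2 ?leUx ?ab].
  - by move=> [a Sa ba]; apply: nSb; rewrite (le_anti ba).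
have [C [p [hp sp pU]]] := filter_quotient fU.
have KC : K C by apply: variety_image hp sp.
have totC : chain C.
  move=> x y; have [x' <-] := sp x; have [y' <-] := sp y; apply/orP.
  have /(filter_le fU)/(_ (filter1 fU))/Uprime := prelinearity x' y'.
  by case=> /pU; [left|right].
have [onto|/existsNP[c nSc]] := pselect (forall c, exists2 a, S a & p a = c);
  last first.
  have [D [f [g [KD hf hg fg [x fgx]]]]] :=
    separated_chain KC totC (subalgebra_image sS hp) nSc.
  have [y yx] := sp x.
  exists D, (f \o p), (g \o p); split=> //; try exact: homomorphism_comp.
    by move=> a Sa; apply: fg; exists a.
  by exists y; rewrite /= yx.
pose V x := exists2 a, S a /\ U a & a <= x.
have fV : deductive_filter V.
  split.
  - by exists 1 => //; split=> //; apply: filter1.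
  - by move=> x y xy [a Sa ax]; exists a => //; apply: le_trans xy.
  - move=> x y [a [Sa Ua] ax] [a' [Sa' Ua'] ay].
    exists (Order.meet a a'); last by rewrite leI2.
    by split; [apply: SI|apply: filter_meet].
have [D [q [hq sq qV]]] := filter_quotient fV.
pose r x := projT1 (cid2 (onto (p x))).
have Sr x : S (r x) by rewrite /r; case: cid2.
have pr x : p (r x) = p x by rewrite /r; case: cid2.
(* If [x] and [y] are in [S], then so are [imp x y] and [imp y x]; when these
   are in [U], they are generators of [V]. *)
have pq x y : S x -> S y -> p x = p y -> q x = q y.
  move=> Sx Sy e; apply: le_anti; apply/andP; split; apply/qV.
    exists (imp x y); rewrite ?lexx //.
    by split; [apply: sub_imp|apply/pU; rewrite e].
  exists (imp y x); rewrite ?lexx //.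
  by split; [apply: sub_imp|apply/pU; rewrite e].
have [[p1 pM] _ pI _ pN] := hp; have [[q1 qM] _ qI _ qN] := hq.
exists D, q, (q \o r); split=> //.
- exact: variety_image hq sq.
- apply: homomorphism_of_mul_meet_neg => [|x y|x y|x] /=.
  + by rewrite -q1; apply: pq; rewrite ?pr.
  + by rewrite -qM; apply: pq; rewrite ?pM ?pr ?pM; auto.
  + by rewrite -qI; apply: pq; rewrite ?pI ?pr ?pI; auto.
  + by rewrite -qN; apply: pq; rewrite ?pN ?pr ?pN; auto.
- by move=> a Sa; apply: pq; rewrite ?pr.
- exists b => /= e.
  have /(one_le_quotient hq qV)[a [Sa Ua] ab] : 1 <= q b.
    rewrite e; apply/(one_le_quotient hq qV); exists (r b) => //; split=> //.
    by apply/(one_le_quotient hp pU); rewrite pr; apply/(one_le_quotient hp pU).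
  by apply: (UI a Ua); exists a; rewrite ?lexx.
Qed.

Lemma epimorphism_surjective A B (h : A -> B) :
  K B -> epimorphism K h -> forall b, exists a, h a = b.
Proof.
move=> KB [hh epi] b; apply: contrapT => nb.
have sT : subalgebra (fun _ : A => True) by split.
have [|C [f [g [KC hf hg fg [x []]]]]] :=
    proper_subalgebra_separated KB (subalgebra_image sT hh) (b := b).
  by move=> [a _ ab]; apply: nb; exists a.
by apply: epi => // a; apply: fg; exists a.
Qed.

End Separation.

(** * Lindenbaum algebras and the Beth property *)

Section Lindenbaum.
Context (d : Order.disp_t) (K : set (sugiharaType d)).

Lemma logic_of_valid V (G : set (formula V)) a :
  (forall (A : sugiharaType d) (v : V -> A), K A -> 1 <= eval v a) ->
  logic_of K G a.
Proof.
by move=> h; exists set0; split=> [||A v KA _]; [|exact: sub0set|exact: h].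
Qed.

Lemma logic_of_assumption V (G : set (formula V)) a : G a -> logic_of K G a.
Proof.
move=> Ga; exists [set a]; split=> [|_ ->//|A v KA]; first exact: finite_set1.
by apply.
Qed.

Lemma logic_of_rule V (G : set (formula V)) a b c :
    (forall (A : sugiharaType d) (v : V -> A), 1 <= eval v a ->
      1 <= eval v b -> 1 <= eval v c) ->
  logic_of K G a -> logic_of K G b -> logic_of K G c.
Proof.
move=> h [H [fH HG ha]] [H' [fH' HG' hb]]; exists (H `|` H'); split.
- by rewrite finite_setU.
- by rewrite subUset.
- move=> A v KA hv.
  by apply: h; [apply: ha|apply: hb] => // e He; apply: hv; [left|right].
Qed.

Section Quotient.
Context (V : Type) (G : set (formula V)).

Let leL (a b : formula V) := logic_of K G (Imp a b).

Lemma lindenbaum_valid a b :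
    (forall (A : sugiharaType d) (v : V -> A), eval v a <= eval v b) ->
  leL a b.
Proof. by move=> h; apply: logic_of_valid => A v _; rewrite /= one_le_imp. Qed.

Lemma lindenbaum_rule a b a' b' c c' :
    (forall (A : sugiharaType d) (v : V -> A), eval v a <= eval v b ->
      eval v a' <= eval v b' -> eval v c <= eval v c') ->
  leL a b -> leL a' b' -> leL c c'.
Proof.
by move=> h; apply: logic_of_rule => A v /=; rewrite !one_le_imp; apply: h.
Qed.

Definition lindenbaum_presugihara : presugihara (formula V).
Proof.
refine (@Presugihara _ (@Mul V) Unit (@Imp V) (@Meet V) (@Join V) (@Neg V) leL
  _ _ _ _ _ _ _ _ _ _ _ _ _ _ _ _ _ _ _).
- by move=> x; apply: lindenbaum_valid.
- by move=> y x z; apply: lindenbaum_rule => A v; apply: le_trans.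
- by move=> x y; apply: lindenbaum_valid => A v; apply: leIl.
- by move=> x y; apply: lindenbaum_valid => A v; apply: leIr.
- by move=> x y z; apply: lindenbaum_rule => A v /=; rewrite lexI => -> ->.
- by move=> x y; apply: lindenbaum_valid => A v; apply: leUl.
- by move=> x y; apply: lindenbaum_valid => A v; apply: leUr.
- by move=> x y z; apply: lindenbaum_rule => A v /=; rewrite leUx => -> ->.
- by move=> x y z; apply: lindenbaum_valid => A v /=; rewrite meetUl.
- by move=> x y z; apply: lindenbaum_valid => A v /=; rewrite mulgA.
- by move=> x y; apply: lindenbaum_valid => A v /=; rewrite mulgC.
- by move=> x; apply: lindenbaum_valid => A v /=; rewrite mul1g.
- by move=> x; apply: lindenbaum_valid => A v /=; rewrite mul1g.
- by move=> x; apply: lindenbaum_valid => A v /=; rewrite mulgg.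
- by move=> x; apply: lindenbaum_valid => A v /=; rewrite mulgg.
- move=> x y z; split=> h; apply: (lindenbaum_rule _ h h) => A v /= le_xyz _;
  by [rewrite -residuation|rewrite residuation].
- by move=> x; apply: lindenbaum_valid => A v /=; rewrite negK.
- by move=> x; apply: lindenbaum_valid => A v /=; rewrite negK.
- by move=> x y; apply: lindenbaum_valid => A v /=; rewrite imp_neg.
Defined.

End Quotient.

Lemma eval_subst V W (A : sugiharaType d) (v : W -> A) (s : V -> formula W) a :
  eval v (subst s a) = eval (fun x => eval v (s x)) a.
Proof. by elim: a => //= [a -> b ->|a -> b ->|a -> b ->|a -> b ->|a ->]. Qed.

(** The algebra belongs to [K] because the equations that define [K] are
    preserved by substitution of formulas, and so hold between classes. *)
Lemma lindenbaum_algebra V (G : set (formula V)) : variety K ->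
  exists (B : sugiharaType d) (v : V -> B),
    [/\ K B, forall b, exists a, eval v a = b &
      forall a b, eval v a <= eval v b <-> logic_of K G (Imp a b)].
Proof.
move=> vK; have [B [p [sp pG p1 [pM pi pI pJ pN]]]] :=
  presugihara_quotient d (lindenbaum_presugihara G).
pose v x := p (Var x).
have pE a : p a = eval v a.
  elim: a => //= [a <- b <-|a <- b <-|a <- b <-|a <- b <-|a <-];
    by [apply: pM|apply: pi|apply: pI|apply: pJ|apply: pN].
have sv b : exists a, eval v a = b by have [a] := sp b; exists a; rewrite -pE.
exists B, v; split=> // [|a b]; last by rewrite -!pE; apply: pG.
have [E KE] := vK; rewrite KE /= => e Ee u.
pose w n := projT1 (cid (sv (u n))).
have wu n : eval v (w n) = u n by rewrite /w; case: cid.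
rewrite -!(eval_eq wu) -!eval_subst -!pE; apply: le_anti; apply/andP.
by split; apply/pG; apply: logic_of_valid => A t;
  rewrite KE /= one_le_imp => KA; rewrite !eval_subst (KA _ Ee).
Qed.

(** A homomorphism from the Lindenbaum algebra of [G] to [C] is a model of [G]
    in [C].  Two models that agree on [X] become a single valuation of the
    variables in [X + Z + C] once the substitution names the values of the
    second model by variables from [C]. *)
Lemma infinite_Beth_of_variety : variety K -> infinite_Beth (logic_of K).
Proof.
move=> vK X Z G hyp z.
have [B [v [KB sv vG]]] := lindenbaum_algebra G vK.
pose S b := exists p : formula X, eval v (rename inl p) = b.
have sS : subalgebra S.
  split.
  - by exists Unit.
  - by move=> _ _ [p <-] [q <-]; exists (Mul p q).
  - by move=> _ _ [p <-] [q <-]; exists (Meet p q).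
  - by move=> _ [p <-]; exists (Neg p).
have [[p pz]|nSz] := pselect (S (v (inr z))).
  exists p; have := lexx (v (inr z)); rewrite -{2}pz => /(vG (Var _)) h1.
  have := lexx (v (inr z)); rewrite -{1}pz => /(vG _ (Var _)) h2.
  by apply: logic_of_rule h1 h2 => A u /=; rewrite lexI => -> ->.
have [C [f [g [KC hf hg fg [b []]]]]] :=
  proper_subalgebra_separated vK KB sS nSz.
pose s (t : X + Z + C) : formula (X + Z + C) :=
  if t is inl (inr z') then Var (inr (g (v (inr z')))) else Var t.
pose u (t : X + Z + C) : C := match t with inl t => f (v t) | inr c => c end.
have G1f a : G a -> 1 <= f (eval v a) /\ 1 <= g (eval v a).
  move=> Ga; have : eval v Unit <= eval v a.
    have La := logic_of_assumption Ga.
    by apply/vG; apply: (logic_of_rule _ La La) => A t /=; rewrite one_le_imp.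
  have [[f1 _] _ _ _ _] := hf; have [[g1 _] _ _ _ _] := hg.
  by move=> h; split; [rewrite -f1|rewrite -g1]; apply: homomorphism_le.
have fgv t : f (v t) = g (v t).
  case: t => [x|z']; first by apply: fg; exists (Var x).
  have [//|H [_ HG h]] := hyp C s _ z'.
  have : 1 <= eval u (Iff (Var (inl (inr z'))) (s (inl (inr z')))).
    apply: h => // _ /HG[[a Ga <-]|[_ [a Ga <-] <-]].
      rewrite eval_subst -[eval _ a](eval_homomorphism v a hf).
      by have [] := G1f a Ga.
    rewrite !eval_subst; set t := fun x => _.
    have te : t =1 g \o v.
      by move=> [x|z''] //=; rewrite /t /= fg //; exists (Var x).
    by rewrite (eval_eq te) -eval_homomorphism //; have [] := G1f a Ga.
  by rewrite /= lexI !one_le_imp => /le_anti.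
have [a <-] := sv b.
by rewrite !eval_homomorphism //; apply: eval_eq.
Qed.

End Lindenbaum.

Theorem theorem8p5 (d : Order.disp_t) :
  (forall K : set (sugiharaType d), variety K ->
     forall (A B : sugiharaType d) (h : A -> B),
       K A -> K B -> epimorphism K h -> forall b : B, exists a : A, h a = b) /\
  (forall L : logic, RMt_axiomatic_extension d L -> infinite_Beth L).
Proof.
split=> [K vK A B h _|L [K vK LK] X Z G hyp z].
  exact: epimorphism_surjective.
have [W s sX G1 z'|p Gp] := infinite_Beth_of_variety vK (G := G) _ z.
  exact/LK/hyp.
by exists p; apply/LK.
Qed.
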